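(* Let $s$ and $t$ be relatively prime positive integers, and let $X$ denote the size of a partition chosen uniformly at random from the (finite, nonempty) set of $(s,t)$-core partitions. Then the variance of $X$ is $$\mathbf{E}\big[(X-\mathbf{E}[X])^2\big]=\frac{1}{1440}\, s\,t\,(t-1)(s-1)(s+t+1)(s+t).$$
   Context: A partition is a non-increasing finite sequence of positive integers $\lambda=(\lambda_1,\dots,\lambda_k)$, $k\ge 0$ (the empty partition is allowed); its size is $\lambda_1+\dots+\lambda_k$. Its Ferrers diagram consists of the cells $(i,j)$ with $1\le i\le k$, $1\le j\le\lambda_i$. The hook length of cell $(i,j)$ is $\lambda_i-j+\lambda'_j-i+1$, where $\lambda'$ is the conjugate partition ($\lambda'_j$ = number of $i$ with $\lambda_i\ge j$). A partition is an $s$-core if no cell has hook length equal to $s$, and an $(s,t)$-core partition if it is simultaneously an $s$-core and a $t$-core. For coprime $s,t$ the set of $(s,t)$-core partitions is finite, and it is given the uniform probability distribution. *)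

(* Defs.v *)
From mathcomp Require Export all_boot all_order all_algebra finmap.

Set Implicit Arguments.
Unset Strict Implicit.
Unset Printing Implicit Defensive.

Import GRing.Theory.

Definition is_partition (l : seq nat) : bool := sorted geq l && all (ltn 0) l.

(* Parts, columns and cells are numbered from 1. *)
Definition part (l : seq nat) (i : nat) : nat := nth 0 l i.-1.

Definition conj_part (l : seq nat) (j : nat) : nat :=
  count (fun a => j <= a) l.

Definition is_cell (l : seq nat) (i j : nat) : bool :=
  (1 <= i <= size l) && (1 <= j <= part l i).

(* Neither natural-number subtraction truncates at a cell of a partition. *)
Definition hook_length (l : seq nat) (i j : nat) : nat :=
  (part l i - j) + (conj_part l j - i) + 1.

Definition is_core (s : nat) (l : seq nat) : Prop :=
  forall i j, is_cell l i j -> hook_length l i j <> s.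

Definition st_core_partition (s t : nat) (l : seq nat) : Prop :=
  [/\ is_partition l, is_core s l & is_core t l].

Definition partition_size (l : seq nat) : nat := sumn l.

Local Open Scope ring_scope.

Definition unif_expectation (T : choiceType) (C : {fset T}) (X : T -> rat) : rat :=
  (\sum_(x <- C) X x) / (#|` C|)%:R.

Definition unif_variance (T : choiceType) (C : {fset T}) (X : T -> rat) : rat :=
  unif_expectation C (fun x => (X x - unif_expectation C X) ^+ 2).

(* Main.v *)
(* Let N = s + t.  The first-column hooks of an (s,t)-core form a finite set B
   of positive integers stable under b |-> b - s and b |-> b - t.  Let x_p be the
   least natural number outside B with N | x_p + s p.  Then x_(p+1) is x_p + t
   or x_p - s, so the core is encoded by the s-subset P of Z/N of the up-steps,
   and the closed walk x stays nonnegative.  The size of the core is, up to a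
   constant, half the variance of x over one period, namely
     (s^2 - 1)(N^2 - 1)/24 - (1/4) sum_(i, j in P) d (N - d),  d = i - j mod N.
   This expression is invariant under rotation of P, and by the cycle lemma each
   s-subset has exactly one nonnegative rotation among its N rotations.  Hence
   the size of a random core is distributed as this quadratic function of a
   uniformly random s-subset of Z/N, whose second moment only involves the
   probabilities that 2, 3 or 4 given points lie in P. *)
Require Import Defs.
From mathcomp Require Import zify ring.
Import GRing.Theory Num.Theory.

Set Implicit Arguments.
Unset Strict Implicit.
Unset Printing Implicit Defensive.

(** * First-column hooks and cores *)

(** The hook of the first cell of a row is the length of the row plus the number of rows below
    it. *)
Fixpoint first_column_hooks (l : seq nat) : seq nat :=
  if l is a :: l' then a + size l' :: first_column_hooks l' else [::].

Fixpoint hooks_to_partition (B : seq nat) : seq nat :=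
  if B is b :: B' then b - size B' :: hooks_to_partition B' else [::].

Lemma size_first_column_hooks (l : seq nat) :
  size (first_column_hooks l) = size l.
Proof. by elim: l => //= a l ->. Qed.

Lemma size_hooks_to_partition (B : seq nat) :
  size (hooks_to_partition B) = size B.
Proof. by elim: B => //= b B ->. Qed.

Lemma first_column_hooksK : cancel first_column_hooks hooks_to_partition.
Proof. by elim=> //= a l ->; rewrite size_first_column_hooks addnK. Qed.

Lemma geq_trans : transitive geq.
Proof. by move=> y x z /= xy yz; apply: leq_trans yz xy. Qed.

Lemma gtn_trans : transitive gtn.
Proof. by move=> y x z /= xy yz; apply: ltn_trans yz xy. Qed.

Lemma sorted_geq_cons (a : nat) (l : seq nat) :
  sorted geq (a :: l) -> sorted geq l /\ {in l, forall b, b <= a}.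
Proof.
rewrite /= (path_sortedE geq_trans) => /andP[/allP al ->].
by split=> // b /al.
Qed.

Lemma sorted_gtn_cons (a : nat) (l : seq nat) :
  sorted gtn (a :: l) = sorted gtn l && all (gtn a) l.
Proof. by rewrite /= (path_sortedE gtn_trans) andbC. Qed.

Lemma first_column_hooks_lt (a : nat) (l : seq nat) :
  {in l, forall b, b <= a} -> sorted geq l ->
  {in first_column_hooks l, forall b, b < a + size l}.
Proof.
elim: l a => //= c l IH a la /[dup] /sorted_geq_cons[sl lc] _ b.
have ca : c <= a by apply: la; rewrite mem_head.
rewrite inE => /orP[/eqP->|/(IH c lc sl)]; lia.
Qed.

Lemma first_column_hooks_sorted (l : seq nat) :
  sorted geq l -> sorted gtn (first_column_hooks l).
Proof.
elim: l => // a l IH /sorted_geq_cons[sl la].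
rewrite [first_column_hooks _]/= sorted_gtn_cons IH //=.
by apply/allP => b /(first_column_hooks_lt la sl).
Qed.

Lemma first_column_hooks_gt0 (l : seq nat) :
  all (ltn 0) l -> all (ltn 0) (first_column_hooks l).
Proof. by elim: l => //= a l IH /andP[a0 /IH ->]; rewrite andbT; lia. Qed.

Lemma sorted_gtn_size (b : nat) (B : seq nat) :
  sorted gtn (b :: B) -> size B <= b.
Proof.
elim: B b => // c B IH b; rewrite sorted_gtn_cons => /andP[/IH sB /andP[/= cb _]].
by apply: leq_ltn_trans cb.
Qed.

Lemma sorted_gtn_size_gt0 (b : nat) (B : seq nat) :
  sorted gtn (b :: B) -> all (ltn 0) (b :: B) -> size B < b.
Proof.
elim: B b => [|c B IH] b; first by move=> _ /andP[].
rewrite sorted_gtn_cons => /andP[/IH sB /andP[/= cb _]] /andP[_ /sB].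
by move=> /leq_ltn_trans; apply.
Qed.

Lemma hooks_to_partitionK (B : seq nat) :
  sorted gtn B -> first_column_hooks (hooks_to_partition B) = B.
Proof.
elim: B => // b B IH sbB; have := sbB; rewrite sorted_gtn_cons => /andP[sB _].
by rewrite /= IH // size_hooks_to_partition subnK // sorted_gtn_size.
Qed.

Lemma hooks_to_partition_is_partition (B : seq nat) :
  sorted gtn B -> all (ltn 0) B -> is_partition (hooks_to_partition B).
Proof.
rewrite /is_partition.
elim: B => // b B IH sbB /andP[b0 B0].
have := sbB; rewrite sorted_gtn_cons => /andP[sB bB].
have /andP[sP P0] := IH sB B0.
have bs : size B < b by apply: sorted_gtn_size_gt0 sbB _; apply/andP.
rewrite /= subn_gt0 bs P0 /= andbT.
case: B sB bB sP {bs B0 P0 sbB IH} => //= c B sB /andP[cb _] sP.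
by rewrite /= sP andbT; lia.
Qed.

(** The rows below contribute [0 + 1 + ... + (size l - 1)]. *)
Lemma sumn_first_column_hooks (l : seq nat) :
  sumn (first_column_hooks l) = sumn l + 'C(size l, 2).
Proof. elim: l => //= a l ->; rewrite binS bin1; lia. Qed.

Lemma conj_part_cons (a : nat) (l : seq nat) (j : nat) :
  conj_part (a :: l) j = (j <= a) + conj_part l j.
Proof. by []. Qed.

Lemma conj_part_eq0 (a : nat) (l : seq nat) (j : nat) :
  {in l, forall b, b <= a} -> a < j -> conj_part l j = 0.
Proof.
move=> la aj; apply/eqP; rewrite -leqn0 leqNgt -has_count.
by apply/hasPn => b /la; lia.
Qed.

Lemma conj_part_le_size l j : conj_part l j <= size l.
Proof. exact: count_size. Qed.

(* The column [j] of a partition inside a strip of width [a] contributes the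
   non-hook [j - 1 + size l - conj_part l j]. *)
Lemma notin_first_column_hooks (a : nat) (l : seq nat) (c : nat) :
  {in l, forall b, b <= a} -> sorted geq l -> c < a + size l ->
  reflect (exists2 j, 1 <= j <= a & c + conj_part l j = j.-1 + size l)
          (c \notin first_column_hooks l).
Proof.
elim: l a => [|b l IH] a la sl cl.
  apply: (iffP idP) => // _; exists c.+1 => //; move: cl; rewrite /conj_part /=; lia.
have [sl' lb] := sorted_geq_cons sl.
have ba : b <= a by apply: la; rewrite mem_head.
have big j := @conj_part_eq0 b l j lb.
rewrite [first_column_hooks _]/= [size _]/= inE negb_or.
have {}cl : c < a + (size l).+1 := cl.
case: (ltngtP c (b + size l)) => cb; rewrite ?andTb ?andFb.
- apply: (iffP (IH b lb sl' cb)) => [] [j jb ej].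
    by exists j; [lia | rewrite conj_part_cons; lia].
  move: ej; rewrite conj_part_cons.
  case: (leqP j b) => [jb'|/[dup] bj /big ->] ej; last by exfalso; lia.
  by exists j; lia.
- apply: (iffP idP) => [_|_]; last first.
    by apply/negP => /(first_column_hooks_lt lb sl'); lia.
  exists (c - size l); first by lia.
  by rewrite conj_part_cons big; lia.
- constructor=> -[j jb]; rewrite conj_part_cons.
  have [jb'|/[dup] bj /big ->] := leqP j b; last by lia.
  by have := conj_part_le_size l j; lia.
Qed.

Lemma mem_part (l : seq nat) (i : nat) : 1 <= i <= size l -> part l i \in l.
Proof. by case: i => // i il; apply: mem_nth. Qed.

(** Hooks of lower rows survive the removal of the first row: their columns lose one cell while the
    row index drops by one. *)
Lemma is_core_cons (s a : nat) (l : seq nat) : sorted geq (a :: l) ->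
  is_core s (a :: l) <->
  is_core s l /\ forall j, 1 <= j <= a -> a - j + conj_part l j + 1 <> s.
Proof.
move=> /sorted_geq_cons[sl la]; split.
  move=> core; split=> [i j|j ja].
    rewrite /is_cell /hook_length => /andP[il jl] hs.
    have pa := la _ (mem_part il).
    have ep : part (a :: l) i.+1 = part l i.
      by rewrite /part; case: i il {jl pa hs} => [|i] //=.
    apply: (core i.+1 j); first by rewrite /is_cell ep /=; lia.
    rewrite /hook_length ep conj_part_cons; lia.
  move=> hs; apply: (core 1 j); first by rewrite /is_cell /part /=; lia.
  by rewrite /hook_length conj_part_cons /part [nth _ _ _]/=; lia.
move=> [core row1] [|[|i]] j; rewrite /is_cell /hook_length //.
  have -> : part (a :: l) 1 = a by [].
  rewrite conj_part_cons => /andP[_ jl].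
  by have := row1 j jl; lia.
have -> : part (a :: l) i.+2 = part l i.+1 by [].
move=> /andP[il jl] hs.
have pa := la _ (@mem_part l i.+1 il).
apply: (core i.+1 j); first by rewrite /is_cell jl andbT; exact: il.
by move: hs; rewrite /hook_length conj_part_cons; lia.
Qed.

(** By [notin_first_column_hooks], the hooks in the top row are the differences between its
    first-column hook and the smaller naturals outside the set; induction handles the other rows. *)
Lemma is_core_first_column_hooks (s : nat) (l : seq nat) :
  0 < s -> sorted geq l ->
  is_core s l <->
  {in first_column_hooks l, forall b, s <= b -> b - s \in first_column_hooks l}.
Proof.
move=> s0; elim: l => [|a l IH] sal; first by split=> // _ [|i] j.
have [sl la] := sorted_geq_cons sal.
rewrite (is_core_cons s sal) (IH sl) /=; split.
  move=> [cl row1] b; rewrite inE => /orP[/eqP-> sa|bl sb]; last first.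
    by rewrite inE cl // orbT.
  rewrite inE; apply/orP; right; apply/negPn/negP.
  move/(notin_first_column_hooks la sl) => []; first by lia.
  move=> j ja ej; apply: (row1 j ja); lia.
move=> cl; split=> [b bl sb|j ja hs].
  have := cl b; rewrite !inE bl orbT => /(_ isT sb) /orP[/eqP eb|//].
  by have := first_column_hooks_lt la sl bl; lia.
have cj := conj_part_le_size l j.
have : a + size l - s \notin first_column_hooks l.
  apply/(notin_first_column_hooks la sl); first by lia.
  exists j => //; lia.
have := cl (a + size l); rewrite !inE eqxx => /(_ isT) H.
have /H/orP[/eqP|->//] : s <= a + size l by lia.
lia.
Qed.

(** * Cores as nonnegative closed walks *)

Section Levels.

Variables (s n : nat).

Implicit Types (P Q : {set 'I_n.+1}) (b p q : nat).

Definition ups P p := \sum_(0 <= q < p) (inZp q \in P).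

(* The subtraction does not truncate when [P] is [dyck]. *)
Definition level P p := n.+1 * ups P p - s * p.

Definition dyck P := [forall p : 'I_n.+1, s * p <= n.+1 * ups P p].

(** For [dyck] sets, [level P p] is congruent to [- s * p], and the gaps are the naturals below the
    level in its residue class. They serve as the first-column hooks of a core. *)
Definition gap P b :=
  [exists p : 'I_n.+1, (b < level P p) && (n.+1 %| b + s * p)].

Lemma upsS P p : ups P p.+1 = ups P p + (inZp p \in P).
Proof. by rewrite /ups big_nat_recr. Qed.

Lemma ups_le P p : ups P p <= p.
Proof.
elim: p => [|p IH]; first by rewrite /ups big_geq.
by rewrite upsS; have := leq_b1 (inZp p \in P); lia.
Qed.

Lemma inZp_addN p : inZp (p + n.+1) = inZp p :> 'I_n.+1.
Proof. by apply/val_inj; rewrite /= modnDr. Qed.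

Lemma ups_card P : ups P n.+1 = #|P|.
Proof.
rewrite /ups big_mkord -sum1_card [RHS]big_mkcond /=.
by apply: eq_bigr => i _; rewrite valZpK; case: (i \in P).
Qed.

Lemma ups_addN P p : ups P (p + n.+1) = ups P p + #|P|.
Proof.
elim: p => [|p IH]; first by rewrite ups_card {1}/ups big_geq.
by rewrite addSn !upsS IH inZp_addN; lia.
Qed.

Lemma ups_addMN P p k : ups P (p + k * n.+1) = ups P p + k * #|P|.
Proof.
elim: k => [|k IH]; first by rewrite !mul0n !addn0.
by rewrite mulSn [n.+1 + _]addnC addnA ups_addN IH; lia.
Qed.

(** Over one period both terms of the difference grow by [n.+1 * s]. *)
Lemma level_mod P p : #|P| = s -> level P (p %% n.+1) = level P p.
Proof.
move=> cP; rewrite /level {3 4}(divn_eq p n.+1) addnC ups_addMN cP.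
move: (p %/ _) (p %% _) => k r.
rewrite [s * (_ + _)]mulnDr mulnDr.
have -> : s * (k * n.+1) = n.+1 * (k * s) by lia.
by rewrite subnDr.
Qed.

Lemma dyckP P : #|P| = s ->
  reflect (forall p, s * p <= n.+1 * ups P p) (dyck P).
Proof.
move=> cP; apply: (iffP forallP) => [D p|D p]; last exact: D.
rewrite (divn_eq p n.+1) addnC ups_addMN cP.
have := D (inZp p); rewrite /=; move: (p %/ _) (p %% _) => k r.
have -> : s * (r + k * n.+1) = s * r + n.+1 * (k * s) by lia.
by rewrite mulnDr leq_add2r.
Qed.

Lemma gapP P b : #|P| = s ->
  reflect (exists2 p, b < level P p & n.+1 %| b + s * p) (gap P b).
Proof.
move=> cP; apply: (iffP existsP) => [[p /andP[bp Np]]|[p bp Np]].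
  by exists p.
exists (inZp p); rewrite /= level_mod // bp /=.
by rewrite /dvdn -modnDmr modnMmr modnDmr.
Qed.

Lemma dvdn_add_level P p : s * p <= n.+1 * ups P p ->
  level P p + s * p = n.+1 * ups P p.
Proof. by move=> ?; rewrite /level subnK. Qed.

Hypothesis co_sn : coprime s n.+1.

(** Since [s] is invertible modulo [n.+1], a residue class determines its index. *)
Lemma dvdn_index_eq b c p q : b = c %[mod n.+1] ->
  n.+1 %| b + s * p -> n.+1 %| c + s * q -> p = q %[mod n.+1].
Proof.
wlog pq : b c p q / p <= q => [W bc bp cq|].
  have [pq|/ltnW qp] := leqP p q; first exact: W bp cq.
  by apply/esym; apply: W cq bp.
move=> bc; rewrite /dvdn -modnDml bc modnDml -!/(dvdn _ _) => bp cq.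
have : n.+1 %| s * (q - p).
  have -> : s * (q - p) = (c + s * q) - (c + s * p) by rewrite mulnBr subnDl.
  by rewrite dvdn_sub.
rewrite Gauss_dvdr 1?coprime_sym // => d.
by apply/esym/eqP; rewrite eqn_mod_dvd.
Qed.

(** * Gaps of a nonnegative closed walk *)

Section DyckSet.

Variable P : {set 'I_n.+1}.
Hypothesis cP : #|P| = s.
Hypothesis dP : dyck P.

Let le_ups p : s * p <= n.+1 * ups P p.
Proof. by apply/dyckP. Qed.

Lemma level_dvdn p : n.+1 %| level P p + s * p.
Proof. by rewrite dvdn_add_level // dvdn_mulr. Qed.

Lemma level0 : level P 0 = 0.
Proof. by rewrite /level /ups big_geq // muln0. Qed.

Lemma levelS p :
  level P p.+1 + s = level P p + (if inZp p \in P then n.+1 else 0).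
Proof.
have := dvdn_add_level (le_ups p.+1); have := dvdn_add_level (le_ups p).
rewrite upsS; case: ifP => _ /=; rewrite mulnDr mulnS; lia.
Qed.

Lemma level_le p : level P p <= n.+1 * p.
Proof. by rewrite (leq_trans (leq_subr _ _)) // leq_mul2l ups_le orbT. Qed.

Lemma level_index b p q : n.+1 %| b + s * p -> n.+1 %| b + s * q ->
  level P p = level P q.
Proof.
move=> bp bq; rewrite -(level_mod p cP) -(level_mod q cP).
by rewrite (dvdn_index_eq _ bp bq).
Qed.

Lemma gap_index b p : n.+1 %| b + s * p -> gap P b = (b < level P p).
Proof.
move=> bp; apply/(gapP _ cP)/idP => [[q bq Nq]|bq]; last by exists p.
by rewrite (level_index bp Nq).
Qed.

Lemma gap_gt0 b : gap P b -> 0 < b.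
Proof.
case: b => // /[!(@gap_index 0 0)]; last by rewrite muln0.
by rewrite level0.
Qed.

Lemma gap_lt b : gap P b -> b < n.+1 * n.+1.
Proof.
case/existsP=> p /andP[bp _]; apply: leq_trans bp _.
apply: leq_trans (level_le _) _; rewrite leq_mul2l /=; exact: ltnW.
Qed.

(** Subtracting [s] moves the index from [p] to [p + 1], where the level is lower by at most [s]. *)
Lemma gap_subs b : gap P b -> s <= b -> gap P (b - s).
Proof.
case/(gapP _ cP) => p bp Np sb; apply/(gapP _ cP); exists p.+1.
  by have := levelS p; case: ifP; lia.
by rewrite mulnS addnA subnK.
Qed.

(** Subtracting [t] moves the index from [p] to [p - 1], written [p + n]; one step raises the level
    by at most [t]. *)
Lemma gap_subt t b : 0 < s -> s + t = n.+1 -> gap P b -> t <= b -> gap P (b - t).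
Proof.
move=> s_gt0 stE; case/(gapP _ cP) => p bp Np tb; apply/(gapP _ cP); exists (p + n).
  have := levelS (p + n); rewrite -addnS -(level_mod (p + _) cP) modnDr level_mod //.
  by case: ifP; lia.
have -> : b - t + s * (p + n) = b + s * p + (s - 1) * n.+1 by nia.
by rewrite dvdn_addl // dvdn_mull.
Qed.

(** By [gap_lt] the range contains all gaps of a [dyck] set of size [s]; [rev] makes the list
    decreasing, like a list of first-column hooks. *)
Definition gaps := rev [seq b <- iota 0 (n.+1 * n.+1) | gap P b].

Lemma mem_gaps b : (b \in gaps) = gap P b.
Proof.
rewrite mem_rev mem_filter mem_iota add0n /=.
by case: (boolP (gap P b)) => // /gap_lt ->.
Qed.

Lemma gaps_sorted : sorted gtn gaps.
Proof.
rewrite /gaps rev_sorted; apply: sorted_filter; first exact: ltn_trans.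
exact: iota_ltn_sorted.
Qed.

End DyckSet.

Definition core_of P := hooks_to_partition (gaps P).

Hypothesis s_gt0 : 0 < s.

Lemma exists_index b : exists2 p, p <= n & n.+1 %| b + s * p.
Proof.
case: (egcdnP n.+1 s_gt0) => u v euv _.
(* Modulo [n.+1], [u] inverts [s] and [n] stands for [-1], so the witness is [- b / s]. *)
exists ((u * (b * n)) %% n.+1); first by rewrite -ltnS ltn_mod.
have g1 : gcdn s n.+1 = 1 by apply/eqP.
rewrite /dvdn -modnDmr modnMmr modnDmr -/(dvdn _ _).
have -> : b + s * (u * (b * n)) = n.+1 * b + (u * s - 1) * (b * n).
  rewrite euv g1; nia.
rewrite euv g1 addnK; apply: dvdn_add; first exact: dvdn_mulr.
by rewrite dvdn_mulr // dvdn_mull.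
Qed.

Variable t : nat.
Hypothesis stE : s + t = n.+1.

Lemma core_of_st_core P : 0 < t -> #|P| = s -> dyck P ->
  st_core_partition s t (core_of P).
Proof.
move=> t_gt0 cP dP; have sg := gaps_sorted P.
have pP : is_partition (core_of P).
  apply: hooks_to_partition_is_partition => //.
  by apply/allP => b; rewrite mem_gaps // => /(gap_gt0 cP).
have [sP _] := andP pP.
split=> //; apply/is_core_first_column_hooks => // b;
  rewrite /core_of hooks_to_partitionK // !mem_gaps //.
- exact: gap_subs.
- exact: gap_subt.
Qed.

(** Otherwise [level Q p] itself would be a gap of [P] but not of [Q]. *)
Lemma level_le_of_gap P Q p : #|P| = s -> dyck P -> #|Q| = s -> dyck Q ->
  (forall b, gap P b -> gap Q b) -> level P p <= level Q p.
Proof.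
move=> cP dP cQ dQ PQ; rewrite leqNgt; apply/negP => QP.
have Nq := level_dvdn cQ dQ p.
suff /PQ : gap P (level Q p) by rewrite (gap_index cQ Nq) ltnn.
by rewrite (gap_index cP Nq).
Qed.

(** Gaps determine levels, levels determine [ups], and the increments of [ups] give the set. *)
Lemma core_of_inj P Q : #|P| = s -> dyck P -> #|Q| = s -> dyck Q ->
  core_of P = core_of Q -> P = Q.
Proof.
move=> cP dP cQ dQ /(congr1 first_column_hooks).
rewrite !hooks_to_partitionK ?gaps_sorted // => eg.
have gPQ b : gap P b = gap Q b by rewrite -!mem_gaps // eg.
have uPQ p : ups P p = ups Q p.
  have : level P p = level Q p.
    by apply/eqP; rewrite eqn_leq !level_le_of_gap // => b; rewrite gPQ.
  move=> /(congr1 (addn^~ (s * p))); rewrite !dvdn_add_level; first last.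
  - by apply/dyckP.
  - by apply/dyckP.
  by move/eqP; rewrite eqn_mul2l => /eqP.
apply/setP => i; have := uPQ i.+1; rewrite !upsS uPQ valZpK => /addnI.
by case: (i \in P); case: (i \in Q).
Qed.

(** * From the hooks of a core back to a walk *)

Section CoreToDyck.

Variable B : seq nat.
Hypothesis B0 : 0 \notin B.
Hypothesis Bs : {in B, forall b, s <= b -> b - s \in B}.
Hypothesis Bt : {in B, forall b, t <= b -> b - t \in B}.

Let nonhook p x := (n.+1 %| x + s * p) && (x \notin B).

Let exists_nonhook p : exists x, nonhook p x.
Proof.
have [m _ Nm] := exists_index (s * p).
(* The first term has the required residue, the second exceeds every element of [B]. *)
pose x := s * m + n.+1 * \max_(b <- B) b.+1.
exists x; rewrite /nonhook /x; apply/andP; split.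
  rewrite addnAC dvdn_addl; last exact: dvdn_mulr.
  by rewrite addnC.
apply/negP => xB.
have : x < \max_(b <- B) b.+1 by exact: (@leq_bigmax_seq _ B xpredT succn x xB isT).
rewrite /x; nia.
Qed.

Let x p := ex_minn (exists_nonhook p).

Let x_dvdn p : n.+1 %| x p + s * p.
Proof. by rewrite /x; case: ex_minnP => m /andP[]. Qed.

Let x_notin p : x p \notin B.
Proof. by rewrite /x; case: ex_minnP => m /andP[]. Qed.

Let x_min p y : n.+1 %| y + s * p -> y \notin B -> x p <= y.
Proof.
by move=> Ny yB; rewrite /x; case: ex_minnP => m _; apply; rewrite /nonhook Ny.
Qed.

Let x0 : x 0 = 0.
Proof. by apply/eqP; rewrite -leqn0 x_min // muln0. Qed.

Let x_mod p : x (p %% n.+1) = x p.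
Proof.
have e y : (n.+1 %| y + s * (p %% n.+1)) = (n.+1 %| y + s * p).
  by rewrite /dvdn -modnDmr modnMmr modnDmr.
apply/eqP; rewrite eqn_leq; apply/andP; split; apply: x_min => //.
- by rewrite e.
- by rewrite -e.
Qed.

(** Stability of [B] puts [x p.+1] between [x p - s] and [x p + t]. These bounds differ by [n.+1]
    and both have the residue of [x p.+1], so only they are possible. *)
Let x_step p : x p.+1 = x p + t \/ x p.+1 + s = x p.
Proof.
have le1 : x p.+1 <= x p + t.
  apply: x_min.
    have -> : x p + t + s * p.+1 = x p + s * p + n.+1 by rewrite -stE; lia.
    by rewrite dvdn_addl.
  by apply/negP => /Bt; rewrite leq_addl addnK => /(_ isT); apply/negP.
have le2 : x p <= x p.+1 + s.
  apply: x_min; first by have := x_dvdn p.+1; rewrite mulnS addnA.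
  by apply/negP => /Bs; rewrite leq_addl addnK => /(_ isT); apply/negP.
have : n.+1 %| (x p + s * p + n.+1) - (x p.+1 + s * p.+1).
  by rewrite dvdn_sub // dvdn_addl.
have -> : x p + s * p + n.+1 - (x p.+1 + s * p.+1) = x p + t - x p.+1 by lia.
case/dvdnP => -[|[|k]] e; [left | right | right]; nia.
Qed.

Lemma dyck_of_hooks : exists P,
  [/\ #|P| = s, dyck P & forall b, gap P b = (b \in B)].
Proof.
pose P := [set i : 'I_n.+1 | x i.+1 == x i + t].
have xS p : (inZp p \in P) = (x p.+1 == x p + t).
  by rewrite inE /= -x_mod -addn1 modnDml addn1 x_mod x_mod.
have upsE p : n.+1 * ups P p = x p + s * p.
  elim: p => [|p IH]; first by rewrite /ups big_geq // x0 !muln0.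
  rewrite upsS mulnDr IH xS mulnS.
  case: (x_step p) => e; first by rewrite e eqxx muln1; lia.
  have -> : (x p.+1 == x p + t) = false by apply/eqP; lia.
  by rewrite muln0; lia.
have cP : #|P| = s.
  (* The walk closes up: [x n.+1 = 0] forces exactly [s] up-steps. *)
  rewrite -ups_card; apply/eqP; have := upsE n.+1; rewrite -x_mod modnn x0 add0n.
  by rewrite mulnC => /eqP; rewrite eqn_mul2r.
have dP : dyck P by apply/dyckP => // p; rewrite upsE leq_addl.
have lE p : level P p = x p by rewrite /level upsE addnK.
exists P; split=> // b.
have [p _ Np] := exists_index b.
rewrite (gap_index cP Np) lE; apply/idP/idP => [bx|bB].
  by apply/negPn/negP => /(x_min Np); rewrite leqNgt bx.
(* If [b] were at least [x p], repeatedly subtracting [s + t = n.+1] inside [B] would end at [x p],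
   which is not in [B]. *)
rewrite ltnNge; apply/negP => xb.
have /dvdnP[k ek] : n.+1 %| b - x p.
  have -> : b - x p = (b + s * p) - (x p + s * p) by rewrite subnDr.
  by rewrite dvdn_sub.
have : x p + k * n.+1 \in B by rewrite -ek subnKC.
elim: k {ek} => [|k IH]; first by rewrite addn0; apply/negP.
move=> kB; apply: IH.
have -> : x p + k * n.+1 = x p + k.+1 * n.+1 - s - t by lia.
by apply: Bt; [apply: Bs => //|]; lia.
Qed.

End CoreToDyck.

Lemma st_core_exists_dyck l : 0 < t -> st_core_partition s t l ->
  exists P, [/\ #|P| = s, dyck P & core_of P = l].
Proof.
move=> t_gt0 [/andP[sl l0] /(is_core_first_column_hooks s_gt0 sl) cs].
move=> /(is_core_first_column_hooks t_gt0 sl) ct.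
have B0 : 0 \notin first_column_hooks l.
  by apply/negP => /(allP (first_column_hooks_gt0 l0)).
have [P [cP dP gP]] := dyck_of_hooks B0 cs ct.
exists P; split=> //; rewrite -[RHS]first_column_hooksK /core_of.
congr hooks_to_partition; apply: (irr_sorted_eq gtn_trans).
- by move=> y /=; rewrite ltnn.
- exact: gaps_sorted.
- exact: first_column_hooks_sorted.
- by move=> b; rewrite mem_gaps // gP.
Qed.

End Levels.

(** * Power sums and arc lengths *)

Local Open Scope ring_scope.

Lemma natr_bin2 (m : nat) : 'C(m, 2)%:R = m%:R * (m%:R - 1) / 2 :> rat.
Proof.
elim: m => [|m IH]; first by rewrite mulr0n !mul0r.
by rewrite binS bin1 natrD IH -natr1; field.
Qed.

Lemma sum_natr1 (m : nat) :
  \sum_(0 <= p < m) p%:R = m%:R * (m%:R - 1) / 2 :> rat.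
Proof.
elim: m => [|m IH]; first by rewrite big_geq // mulr0n !mul0r.
by rewrite big_nat_recr //= IH -natr1; field.
Qed.

Lemma sum_natr2 (m : nat) : \sum_(0 <= p < m) p%:R ^+ 2 =
  m%:R * (m%:R - 1) * (2 * m%:R - 1) / 6 :> rat.
Proof.
elim: m => [|m IH]; first by rewrite big_geq // mulr0n !mul0r.
by rewrite big_nat_recr //= IH -natr1; field.
Qed.

Lemma sum_natr3 (m : nat) : \sum_(0 <= p < m) p%:R ^+ 3 =
  m%:R ^+ 2 * (m%:R - 1) ^+ 2 / 4 :> rat.
Proof.
elim: m => [|m IH]; first by rewrite big_geq // mulr0n expr0n !mul0r.
by rewrite big_nat_recr //= IH -natr1; field.
Qed.

Lemma sum_natr4 (m : nat) : \sum_(0 <= p < m) p%:R ^+ 4 =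
  m%:R * (m%:R - 1) * (2 * m%:R - 1) * (3 * m%:R ^+ 2 - 3 * m%:R - 1) / 30 :> rat.
Proof.
elim: m => [|m IH]; first by rewrite big_geq // mulr0n !mul0r.
by rewrite big_nat_recr //= IH -natr1; field.
Qed.

Lemma sum_natr_gt (i m : nat) : (i < m)%N ->
  \sum_(0 <= p < m) (i < p)%:R = m%:R - 1 - i%:R :> rat.
Proof.
elim: m => // m IH; rewrite ltnS big_nat_recr //= => /[dup] im.
rewrite leq_eqVlt => /orP[/eqP <-|/[dup] im' /IH ->]; last first.
  by rewrite im' mulr1n -[m.+1%:R]natr1; ring.
rewrite ltnn big_nat_cond big1 => [|p]; first by rewrite mulr0n -[i.+1%:R]natr1; ring.
by rewrite andbT => /andP[_ pi]; rewrite ltnNge ltnW.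
Qed.

Lemma sum_natr_gt_mul (i m : nat) : (i < m)%N ->
  \sum_(0 <= p < m) (i < p)%:R * p%:R =
  (m%:R * (m%:R - 1) - i%:R * (i%:R + 1)) / 2 :> rat.
Proof.
elim: m => // m IH; rewrite ltnS big_nat_recr //= => /[dup] im.
rewrite leq_eqVlt => /orP[/eqP <-|/[dup] im' /IH ->]; last first.
  by rewrite im' mulr1n -[m.+1%:R]natr1; field.
rewrite ltnn big_nat_cond big1 => [|p]; first by rewrite mulr0n -[i.+1%:R]natr1; field.
by rewrite andbT => /andP[_ pi]; rewrite ltnNge ltnW // mul0r.
Qed.

Lemma sum_class (R : nmodType) (F : nat -> R) (N k r : nat) : (r < N)%N ->
  \sum_(0 <= b < r + k * N | b == r %[mod N]) F b =
  \sum_(0 <= j < k) F (r + j * N)%N.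
Proof.
move=> rN; elim: k => [|k IH].
  rewrite [RHS]big_geq // mul0n addn0 big_nat_cond big1 // => b.
  rewrite /= => /andP[br /eqP]; rewrite !modn_small //; first by lia.
  exact: ltn_trans rN.
rewrite [RHS]big_nat_recr //= -IH (@big_cat_nat _ _ _ (r + k * N)%N) //=; last first.
  by rewrite leq_add2l leq_mul2r leqnSn orbT.
(* The added block has length [N]; only its left end lies in the class. *)
congr (_ + _); rewrite big_ltn_cond; last by rewrite ltn_add2l ltn_mul2r; lia.
rewrite addnC modnMDl eqxx big_nat_cond big1 ?addr0 // => b.
move=> /andP[/andP[lb ub] /eqP e]; exfalso.
have /eqP : b = r + k * N %[mod N] by rewrite e [(_ + k * N)%N]addnC modnMDl.
rewrite eqn_mod_dvd; last by lia.
move: lb ub; rewrite mulSn; move: (k * N)%N => kN lb ub.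
by move/dvdn_leq; lia.
Qed.

Lemma sum_natr_class (N k r : nat) :
  \sum_(0 <= j < k) ((r + j * N)%N)%:R =
  k%:R * r%:R + N%:R * (k%:R * (k%:R - 1) / 2) :> rat.
Proof.
elim: k => [|k IH]; first by rewrite big_geq // mulr0n !mul0r mulr0 addr0.
by rewrite big_nat_recr //= IH -natr1 natrD natrM; field.
Qed.

Section Arc.

Variable n : nat.
Implicit Types (i j d : 'I_n.+1) (P : {set 'I_n.+1}).

Definition arc d : rat := d%:R * (n.+1%:R - d%:R).

Definition arc_energy P : rat := \sum_(i in P) \sum_(j in P) arc (i - j).

Lemma arcN d : arc (- d) = arc d.
Proof.
rewrite /arc /=; have [->|d0] := eqVneq (d : nat) 0%N.
  by rewrite subn0 modnn !mul0r.
rewrite modn_small; last by lia.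
by rewrite natrB; [ring|exact: ltnW].
Qed.

Lemma arc_sub i j : (j <= i)%N ->
  arc (i - j) = (i%:R - j%:R) * (n.+1%:R - (i%:R - j%:R)).
Proof.
move=> ji; suff e : (i - j : 'I_n.+1) = (i - j)%N :> nat by rewrite /arc e natrB.
rewrite /= modnDmr addnBA; last exact: ltnW.
by rewrite addnC -addnBA // modnDl modn_small //; have := ltn_ord i; lia.
Qed.

Lemma arc0 : arc 0 = 0. Proof. by rewrite /arc mul0r. Qed.

Lemma sum_arc : \sum_d arc d = n.+1%:R * (n.+1%:R ^+ 2 - 1) / 6.
Proof.
rewrite -(big_mkord xpredT (fun d : nat => d%:R * (n.+1%:R - d%:R))).
under eq_bigr do rewrite mulrBr -expr2.
by rewrite sumrB -mulr_suml sum_natr1 sum_natr2; field.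
Qed.

Lemma sum_arc2 : \sum_d arc d ^+ 2 = n.+1%:R * (n.+1%:R ^+ 4 - 1) / 30.
Proof.
rewrite -(big_mkord xpredT (fun d : nat => (d%:R * (n.+1%:R - d%:R)) ^+ 2)).
pose N : rat := n.+1%:R.
transitivity (\sum_(0 <= d < n.+1)
    (d%:R ^+ 2 * N ^+ 2 - d%:R ^+ 3 * (2 * N) + d%:R ^+ 4)).
  by apply: eq_bigr => d _; rewrite -/N; ring.
by rewrite big_split sumrB /= -!mulr_suml sum_natr2 sum_natr3 sum_natr4 /N; field.
Qed.

End Arc.

(** * The size of a core in terms of its up-steps *)

Section Spread.

Variable n : nat.
Implicit Types (i j : 'I_n.+1) (P : {set 'I_n.+1}).

Let N : rat := n.+1%:R.

Lemma natr_ups P (p : 'I_n.+1) :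
  (ups P p)%:R = \sum_(i in P) (i < p)%:R :> rat.
Proof.
rewrite /ups natr_sum big_mkord [RHS]big_mkcond /=.
rewrite (big_ord_widen n.+1 (fun q : nat => (inZp q \in P)%:R)); last exact: ltnW.
rewrite big_mkcond; apply: eq_bigr => i _.
by rewrite valZpK; case: ifP; case: ifP.
Qed.

Lemma sum_step_products i j : (i <= j)%N ->
  \sum_(p < n.+1) (N * (i < p)%:R - p%:R) * (N * (j < p)%:R - p%:R) =
  N ^+ 2 * (N - 1 - j%:R)
  - N * ((N * (N - 1) - i%:R * (i%:R + 1)) / 2
         + (N * (N - 1) - j%:R * (j%:R + 1)) / 2)
  + N * (N - 1) * (2 * N - 1) / 6.
Proof.
move=> ij.
rewrite -(big_mkord xpredT
  (fun p : nat => (N * (i < p)%:R - p%:R) * (N * (j < p)%:R - p%:R))).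
transitivity (\sum_(0 <= p < n.+1) (N ^+ 2 * (j < p)%:R
   - N * ((i < p)%:R * p%:R + (j < p)%:R * p%:R) + p%:R ^+ 2)).
  apply: eq_bigr => p _; case: (ltnP j p) => jp.
    by rewrite (leq_ltn_trans ij jp) mulr1n; ring.
  by rewrite mulr0n; ring.
rewrite big_split sumrB /= -!mulr_sumr big_split /= sum_natr_gt //.
by rewrite !sum_natr_gt_mul // sum_natr2.
Qed.

(** The left side is [N ^+ 2] times the covariance, for uniform [p], of [N * (i < p) - p] and
    [N * (j < p) - p]; the first of these sums to [N * ((N - 1) / 2 - i)]. *)
Lemma sum_step_products_arc i j :
  N * (\sum_(p < n.+1) (N * (i < p)%:R - p%:R) * (N * (j < p)%:R - p%:R))
  - N ^+ 2 * ((N - 1) / 2 - i%:R) * ((N - 1) / 2 - j%:R) =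
  N ^+ 2 * (N ^+ 2 - 1) / 12 - N ^+ 2 / 2 * arc (i - j).
Proof.
wlog ij : i j / (i <= j)%N => [W|].
  have [/W//|/ltnW/W ji] := leqP i j.
  rewrite -arcN opprB -ji; congr (_ * _ - _); last by ring.
  by apply: eq_bigr => p _; ring.
rewrite sum_step_products // -arcN opprB arc_sub // -/N.
by field.
Qed.

(* The levels [N * ups p - s * p] are sums over [i in P] of [N * (i < p) - p],
   so their variance is a double sum over [P]; its terms are arc lengths. *)
Lemma level_spread P (s := #|P|%:R : rat)
    (x := fun p : 'I_n.+1 => N * (ups P p)%:R - s * p%:R) :
  N * (\sum_p x p ^+ 2) - (\sum_p x p) ^+ 2 =
  s ^+ 2 * (N ^+ 2 * (N ^+ 2 - 1) / 12) - N ^+ 2 / 2 * arc_energy P.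
Proof.
pose y (i p : 'I_n.+1) : rat := N * (i < p)%:R - p%:R.
have sE (c : rat) : s * c = \sum_(i in P) c by rewrite sumr_const mulr_natl.
have xE p : x p = \sum_(i in P) y i p.
  by rewrite /x natr_ups sE mulr_sumr -sumrB.
have -> : \sum_p x p ^+ 2 = \sum_(i in P) \sum_(j in P) \sum_p y i p * y j p.
  under eq_bigr do rewrite xE expr2 mulr_suml.
  rewrite exchange_big; apply: eq_bigr => i _.
  under eq_bigr do rewrite mulr_sumr.
  by rewrite exchange_big.
have -> : \sum_p x p = \sum_(i in P) N * ((N - 1) / 2 - i%:R).
  under eq_bigr do rewrite xE.
  rewrite exchange_big; apply: eq_bigr => i _.
  rewrite sumrB -mulr_sumr.
  rewrite -(big_mkord xpredT (fun p : nat => (i < p)%:R)) sum_natr_gt //.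
  rewrite -(big_mkord xpredT (fun p : nat => p%:R)) sum_natr1 -/N.
  by field.
rewrite expr2 [X in _ - X]mulr_suml mulr_sumr expr2 -mulrA sE /arc_energy mulr_sumr.
rewrite -!sumrB; apply: eq_bigr => i _.
rewrite sE !mulr_sumr -!sumrB; apply: eq_bigr => j _.
by rewrite -sum_step_products_arc; ring.
Qed.

End Spread.

(** * From levels to the size of the core *)

Section SizeFormula.

Variables (s n : nat).
Hypothesis s_gt0 : (0 < s)%N.
Hypothesis co_sn : coprime s n.+1.
Variable P : {set 'I_n.+1}.
Hypothesis cP : #|P| = s.
Hypothesis dP : dyck s P.

Let N : rat := n.+1%:R.
Let k (p : 'I_n.+1) := (level s P p %/ n.+1)%N.
Let r (p : 'I_n.+1) := (level s P p %% n.+1)%N.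

(** Each gap has a unique index [p], and the gaps of index [p] form the progression of step [n.+1]
    from the residue [r p] up to the level, excluded. *)
Lemma sum_gaps (F : nat -> rat) :
  \sum_(b <- gaps s P) F b =
  \sum_p \sum_(0 <= j < k p) F (r p + j * n.+1)%N.
Proof.
transitivity (\sum_(0 <= b < n.+1 * n.+1) \sum_(p < n.+1)
   if (b < level s P p)%N && (n.+1 %| b + s * p)%N then F b else 0).
  rewrite /gaps (perm_big _ (permEl (perm_rev _))) big_filter big_mkcond.
  rewrite /index_iota subn0; apply: eq_bigr => b _.
  have [p pn Np] := exists_index co_sn s_gt0 b.
  rewrite (bigD1 (Ordinal (pn : p < n.+1)%N)) //= Np andbT.
  rewrite (gap_index co_sn cP Np) big1 ?addr0 // => q qp.
  case: ifP => // /andP[_ Nq]; case/eqP: qp; apply/val_inj => /=.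
  by have := dvdn_index_eq co_sn (erefl (b %% n.+1)%N) Nq Np; rewrite !modn_small.
rewrite exchange_big /=; apply: eq_bigr => p _.
rewrite -sum_class; last by rewrite ltn_mod.
have eL : level s P p = (r p + k p * n.+1)%N by rewrite addnC -divn_eq.
have Lle : (level s P p <= n.+1 * n.+1)%N.
  by apply: leq_trans (level_le s P p) _; rewrite leq_mul2l /= ltnW.
rewrite -eL (big_nat_widen _ _ _ _ _ Lle) [RHS]big_mkcond /=.
apply: eq_bigr => b _; case: (ltnP b (level s P p)) => bL; last by rewrite andbF.
rewrite andbT /=; congr (if _ then _ else _).
have NL := level_dvdn cP dP p.
rewrite modn_mod eq_sym eqn_mod_dvd; last exact: ltnW.
rewrite -(dvdn_subr _ NL); last by rewrite leq_add2r ltnW.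
by rewrite subnDr.
Qed.

(** Levels at distinct indices are incongruent, so their residues run once through all classes. *)
Lemma sum_level_mod (F : nat -> rat) : \sum_p F (r p) = \sum_(0 <= i < n.+1) F i.
Proof.
rewrite big_mkord.
have inj : injective (fun p : 'I_n.+1 => inZp (level s P p) : 'I_n.+1).
  move=> p q /(congr1 val) /= e; apply/val_inj => /=.
  have := dvdn_index_eq co_sn e (level_dvdn cP dP p) (level_dvdn cP dP q).
  by rewrite !modn_small.
by rewrite [RHS](reindex_inj inj).
Qed.

(** The size is the sum of the gaps minus the binomial coefficient of their number. Both are
    expressed by levels and residues; the residue sums are constants, and the terms linear in the
    levels cancel. *)
Lemma size_core_of_levels :
  (partition_size (core_of s P))%:R =
  (N * (\sum_(p < n.+1) (level s P p)%:R ^+ 2)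
    - (\sum_(p < n.+1) (level s P p)%:R) ^+ 2) / (2 * N ^+ 2)
  - (N ^+ 2 - 1) / 24.
Proof.
have N0 : N != 0 by rewrite pnatr_eq0.
have kE p : (k p)%:R = ((level s P p)%:R - (r p)%:R) / N :> rat.
  by rewrite /r {1}(divn_eq (level s P p) n.+1) natrD natrM addrK mulfK.
pose x (p : 'I_n.+1) : rat := (level s P p)%:R.
pose Sx := \sum_p x p; pose Sxx := \sum_p x p ^+ 2.
have Sr : \sum_p (r p)%:R = N * (N - 1) / 2.
  by rewrite (sum_level_mod (fun i => i%:R)) sum_natr1.
have Srr : \sum_p (r p)%:R ^+ 2 = N * (N - 1) * (2 * N - 1) / 6.
  by rewrite (sum_level_mod (fun i => i%:R ^+ 2)) sum_natr2.
have := sumn_first_column_hooks (core_of s P).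
rewrite hooks_to_partitionK ?gaps_sorted // size_hooks_to_partition.
move=> /(congr1 (fun m : nat => m%:R : rat)).
rewrite natrD natr_bin2 sumnE natr_sum sum_gaps.
have -> : (size (gaps s P))%:R = (Sx - N * (N - 1) / 2) / N.
  rewrite -[size _]sum1_size natr_sum (sum_gaps (fun=> 1)).
  rewrite -Sr /Sx -sumrB mulr_suml; apply: eq_bigr => p _.
  by rewrite sumr_const_nat subn0 kE.
under eq_bigr do rewrite sum_natr_class.
have -> : \sum_p ((k p)%:R * (r p)%:R + N * ((k p)%:R * ((k p)%:R - 1) / 2)) =
    (Sxx - N * (N - 1) * (2 * N - 1) / 6) / (2 * N) - (Sx - N * (N - 1) / 2) / 2.
  rewrite -Sr -Srr /Sx /Sxx -!sumrB !mulr_suml -sumrB.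
  by apply: eq_bigr => p _; rewrite kE /x; field; rewrite nat1r pnatr_eq0.
rewrite -/(partition_size _) -/Sx -/Sxx => /eqP; rewrite -subr_eq => /eqP <-.
by field; rewrite nat1r pnatr_eq0.
Qed.

Lemma size_core_of :
  (partition_size (core_of s P))%:R =
  (s%:R ^+ 2 - 1) * (N ^+ 2 - 1) / 24 - arc_energy P / 4.
Proof.
have N0 : N != 0 by rewrite pnatr_eq0.
rewrite size_core_of_levels.
have lE p : (level s P p)%:R = N * (ups P p)%:R - #|P|%:R * p%:R :> rat.
  by rewrite /level natrB ?natrM ?cP //; apply/dyckP.
under eq_bigr do rewrite lE.
under [\sum_(p < n.+1) (level s P p)%:R]eq_bigr do rewrite lE.
by rewrite level_spread cP -/N; field; rewrite nat1r pnatr_eq0.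
Qed.

End SizeFormula.

(** * Rotations *)

Section Rotation.

Variables (s n : nat).
Hypothesis co_sn : coprime s n.+1.
Implicit Types (r q : 'I_n.+1) (P : {set 'I_n.+1}).

Definition rotate r P := [set i | i + r \in P].

Lemma rotate_inj r : injective (rotate r).
Proof.
move=> P Q /setP e; apply/setP => i.
by have := e (i - r); rewrite !inE subrK.
Qed.

Lemma card_rotate r P : #|rotate r P| = #|P|.
Proof. exact: (card_preimset P (@addIr _ r)). Qed.

Lemma arc_energy_rotate r P : arc_energy (rotate r P) = arc_energy P.
Proof.
rewrite /arc_energy [RHS](reindex_inj (@addIr _ r)).
apply: eq_big => i; first by rewrite inE.
move=> _; rewrite [RHS](reindex_inj (@addIr _ r)).
apply: eq_big => j; first by rewrite inE.
by rewrite opprD addrACA subrr addr0.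
Qed.

Lemma ups_rotate r P (p : nat) :
  (ups (rotate r P) p + ups P r = ups P (p + r))%N.
Proof.
elim: p => [|p IH]; first by rewrite /ups big_geq.
rewrite addSn !upsS -IH inE addnAC; congr (_ + (_ \in P))%N.
by apply/val_inj; rewrite /= modnDml.
Qed.

(** The rotated walk is the original one seen from index [r], so it is nonnegative exactly when [r]
    is a lowest point; terms are moved across to avoid subtraction. *)
Lemma dyck_rotateP r P : #|P| = s ->
  reflect (forall q, n.+1 * ups P r + s * q <= n.+1 * ups P q + s * r)%N
          (dyck s (rotate r P)).
Proof.
move=> cP; have cr : #|rotate r P| = s by rewrite card_rotate.
apply: (iffP (dyckP cr)) => D => [q|p].
  (* In the rotated walk this index corresponds to [q], one period later. *)
  have := D (q + (n.+1 - r))%N; have := ups_rotate r P (q + (n.+1 - r)).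
  have rn := ltn_ord r.
  rewrite -addnA subnK ?(ltnW rn) // ups_addN cP.
  have -> : (s * (q + (n.+1 - r)) = s * q + s * n.+1 - s * r)%N by nia.
  by nia.
have := D (inZp (p + r)); have := ups_rotate r P p.
rewrite {1}(divn_eq (p + r) n.+1) addnC.
rewrite [in X in _ = X](addnC _ (_ %% _)%N) ups_addMN cP /=.
have := divn_eq (p + r) n.+1.
move: (_ %/ _)%N (_ %% _)%N => k m; nia.
Qed.

(* The cycle lemma: the rotation has to start at the lowest level, and levels
   are pairwise incongruent modulo [n.+1]. *)
Lemma dyck_rotate_unique P : #|P| = s ->
  exists r, forall q, dyck s (rotate q P) = (q == r).
Proof.
move=> cP.
(* The height of the walk, raised by the constant [s * n.+1] to stay a natural number. *)
pose h q := (n.+1 * ups P q + s * (n.+1 - q))%N.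
case: (@arg_minnP _ (ord0 : 'I_n.+1) xpredT h isT) => r _ rmin.
have hr : dyck s (rotate r P).
  apply/(dyck_rotateP _ cP) => q; have := rmin q isT; rewrite /h.
  have := ltn_ord q; have := ltn_ord r; nia.
exists r => q; apply/idP/eqP => [hq|-> //].
have /(_ q) le1 := elimT (dyck_rotateP r cP) hr.
have /(_ r) le2 := elimT (dyck_rotateP q cP) hq.
have e : (n.+1 * ups P r + s * q = n.+1 * ups P q + s * r)%N.
  by apply/eqP; rewrite eqn_leq le1 le2.
(* The number [s * r * n] represents [- s * r] modulo [n.+1]; equal heights make [q] another index
   of its class. *)
have Nr : (n.+1 %| s * r * n + s * r)%N by rewrite -mulnSr dvdn_mull.
have Nq : (n.+1 %| s * r * n + s * q)%N.
  rewrite -(dvdn_addr _ (dvdn_mulr (ups P r) (dvdnn n.+1))).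
  rewrite addnCA e addnCA dvdn_addr //; exact: dvdn_mulr.
apply/val_inj => /=.
by have := dvdn_index_eq co_sn (erefl _) Nq Nr; rewrite !modn_small.
Qed.

(** Double counting of pairs [(P, r)] with [rotate r P] nonnegative: each [P] has one such [r],
    while for fixed [r] rotation permutes the [s]-subsets and preserves the energy. *)
Lemma sum_dyck (F : rat -> rat) :
  \sum_(P : {set 'I_n.+1} | #|P| == s) F (arc_energy P) =
  n.+1%:R * \sum_(P : {set 'I_n.+1} | (#|P| == s) && dyck s P) F (arc_energy P).
Proof.
transitivity (\sum_(P : {set 'I_n.+1} | #|P| == s) \sum_r
   if dyck s (rotate r P) then F (arc_energy P) else 0).
  apply: eq_bigr => P /eqP cP; have [r hr] := dyck_rotate_unique cP.
  by rewrite -big_mkcond (eq_bigl _ _ hr) big_pred1_eq.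
rewrite exchange_big /=.
transitivity (\sum_(r < n.+1)
    \sum_(P : {set 'I_n.+1} | (#|P| == s) && dyck s P) F (arc_energy P)); last first.
  by rewrite sumr_const card_ord mulr_natl.
apply: eq_bigr => r _.
rewrite [RHS](reindex_inj (@rotate_inj r)) [RHS]big_mkcondr.
apply: eq_big => P; first by rewrite card_rotate.
by rewrite arc_energy_rotate.
Qed.

End Rotation.

(** * Counting the subsets of given size that contain given points *)

Section Supersets.

Variables (T : finType) (s : nat).

Lemma card_supersets (J : {set T}) : (#|J| <= s)%N ->
  #|[set P : {set T} | J \subset P & #|P| == s]| = 'C(#|T| - #|J|, s - #|J|).
Proof.
move=> Js; rewrite -[(#|T| - #|J|)%N](_ : #|~: J| = _); last first.
  by rewrite [LHS]cardsCs setCK.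
rewrite -cards_draws -[RHS](card_in_imset (f := fun A => J :|: A)); last first.
  move=> A B; rewrite !inE => /andP[/subsetP AJ _] /andP[/subsetP BJ _] /setP e.
  apply/setP => x; have := e x; have := AJ x; have := BJ x; rewrite !inE.
  case: (x \in A); case: (x \in B); case: (x \in J) => //= hB hA hE;
    by [have := hA isT | have := hB isT].
have disj (A : {set T}) : A \subset ~: J -> #|J :|: A| = (#|J| + #|A|)%N.
  by rewrite -disjoints_subset cardsU setIC => /disjoint_setI0 ->;
    rewrite cards0 subn0.
apply: eq_card => P; rewrite [LHS]inE; apply/andP/imsetP => [[JP /eqP cP]|[A]].
  exists (P :\: J); last first.
    apply/setP => x; rewrite !inE.
    by case: (boolP (x \in J)) => //= /(subsetP JP) ->.
  rewrite inE setDE subsetIr -setDE cardsD (setIidPr JP) cP eqxx //.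
rewrite inE => /andP[AJ /eqP cA] ->; rewrite subsetUl disj // cA subnKC //.
Qed.

(** For [m > s] the truncated [s - m] would make the binomial coefficient 1, so the boolean factor
    restores 0. *)
Definition supersets_nb m := ('C(#|T| - m, s - m) * (m <= s))%N.

(** Division-free form of the probability [s ^_ m / #|T| ^_ m] that [m] given points lie in a random
    [s]-subset. *)
Lemma supersets_nb_ffact m : (m <= #|T|)%N ->
  (supersets_nb m * #|T| ^_ m = 'C(#|T|, s) * s ^_ m)%N.
Proof.
rewrite /supersets_nb; have [ms|sm] := leqP m s; last first.
  by rewrite (ffact_small sm) !muln0.
rewrite muln1; elim: m ms => [|m IH] ms mT; first by rewrite !ffactn0 !subn0.
rewrite !ffactnSr !mulnA -IH; [|exact: ltnW|exact: ltnW].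
have := mul_bin_diag (#|T| - m) (s - m.+1).
rewrite -subnS -subSn // subSS => e.
transitivity ((#|T| - m) * 'C(#|T| - m.+1, s - m.+1) * #|T| ^_ m)%N.
  by rewrite mulnAC [X in (X * _)%N]mulnC.
by rewrite e -mulnA mulnC.
Qed.

Lemma sum_supersets (q : seq T) : uniq q ->
  \sum_(P : {set T} | #|P| == s) (all [in P] q)%:R =
  (supersets_nb (size q))%:R :> rat.
Proof.
move=> uq; pose J := [set x in q].
have cJ : #|J| = size q by rewrite cardsE; apply/card_uniqP.
have JP (P : {set T}) : all [in P] q = (J \subset P).
  apply/allP/subsetP => h x; first by rewrite inE; apply: h.
  by move=> xq; apply: h; rewrite inE.
rewrite -natr_sum; congr (_%:R).
under eq_bigr do rewrite JP.
rewrite -big_mkcondr sum1dep_card /supersets_nb -cJ.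
have [Js|sJ] := leqP #|J| s.
  by rewrite muln1 -card_supersets //; apply: eq_card => P; rewrite !inE andbC.
rewrite muln0; apply/eqP; rewrite cards_eq0; apply/eqP/setP => P.
rewrite !inE; apply/negP => /andP[/eqP cP /subset_leq_card].
by rewrite cP leqNgt sJ.
Qed.

End Supersets.

(** * Moments over random subsets *)

Lemma sum_delta (T : finType) (i : T) (F : T -> rat) :
  \sum_k (i == k)%:R * F k = F i.
Proof.
rewrite (bigD1 i) //= eqxx mul1r big1 ?addr0 // => k ki.
by rewrite eq_sym (negPf ki) mul0r.
Qed.

Section Moments.

Variables (s n : nat).
Implicit Types (i j k l : 'I_n.+1) (P : {set 'I_n.+1}).

Let N : rat := n.+1%:R.
Let K1 : rat := \sum_(d < n.+1) arc d.
Let K2 : rat := \sum_(d < n.+1) arc d ^+ 2.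
Let c m : rat := (supersets_nb 'I_n.+1 s m)%:R.

Lemma sum_arc_sub_r i : \sum_j arc (i - j) = K1.
Proof. by rewrite /K1 [RHS](reindex_inj (@subrI _ i)). Qed.

Lemma sum_arc_sub_l j : \sum_i arc (i - j) = K1.
Proof. by rewrite /K1 [RHS](reindex_inj (@addIr _ (- j))). Qed.

Lemma sum_arc2_sub_r i : \sum_j arc (i - j) ^+ 2 = K2.
Proof. by rewrite /K2 [RHS](reindex_inj (@subrI _ i)). Qed.

Lemma sum_const_ord (a : rat) : \sum_(i < n.+1) a = N * a.
Proof. by rewrite sumr_const card_ord mulr_natl. Qed.

Let ind P i : rat := (i \in P)%:R.

Lemma arc_energyE P :
  arc_energy P = \sum_i \sum_j arc (i - j) * (ind P i * ind P j).
Proof.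
rewrite /arc_energy big_mkcond; apply: eq_bigr => i _; rewrite /ind.
case: (i \in P); last first.
  by rewrite big1 // => j _; rewrite mul0r mulr0.
rewrite big_mkcond; apply: eq_bigr => j _.
by case: (j \in P); rewrite ?(mulr1, mulr0).
Qed.

Lemma sum_arc_energy :
  \sum_(P : {set 'I_n.+1} | #|P| == s) arc_energy P = N * K1 * c 2.
Proof.
under eq_bigr do rewrite arc_energyE.
rewrite exchange_big -mulrA -sum_const_ord /=; apply: eq_bigr => i _.
rewrite exchange_big -(sum_arc_sub_r i) mulr_suml /=; apply: eq_bigr => j _.
rewrite -mulr_sumr; have [->|ij] := eqVneq i j; first by rewrite subrr arc0 !mul0r.
congr (_ * _); rewrite /c -[2%N]/(size [:: i; j]) -sum_supersets /=; last first.
  by rewrite inE ij.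
by apply: eq_bigr => P _; rewrite -natrM mulnb andbT.
Qed.

(* On [i != j] and [k != l] the number of coincidences between the two pairs is
   the sum of the four Kronecker deltas, and it is 2 exactly on the last two. *)
Lemma sum_four_points i j k l :
  arc (i - j) * arc (k - l) *
    (\sum_(P : {set 'I_n.+1} | #|P| == s)
       (ind P i * ind P j * (ind P k * ind P l))) =
  arc (i - j) * arc (k - l) *
    (c 4 + (c 3 - c 4) * ((i == k)%:R + (i == l)%:R + (j == k)%:R + (j == l)%:R)
     + (c 2 - 2 * c 3 + c 4)
       * ((i == k)%:R * (j == l)%:R + (i == l)%:R * (j == k)%:R)).
Proof.
have [->|ij] := eqVneq i j; first by rewrite subrr arc0 !mul0r.
have [->|kl] := eqVneq k l; first by rewrite subrr arc0 !(mulr0, mul0r).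
congr (_ * _).
have all_sum (q : seq 'I_n.+1) : uniq q ->
    (forall P, [&& i \in P, j \in P, k \in P & l \in P] = all [in P] q) ->
    \sum_(P : {set 'I_n.+1} | #|P| == s)
       (ind P i * ind P j * (ind P k * ind P l)) = c (size q).
  move=> uq e; rewrite /c -sum_supersets //; apply: eq_bigr => P _.
  by rewrite -e /ind -!natrM !mulnb -andbA.
have [eik|ik] := eqVneq i k.
  subst k; rewrite (negPf kl) [j == i]eq_sym (negPf ij).
  have [ejl|jl] := eqVneq j l.
    subst l; rewrite (all_sum [:: i; j]) /= ?inE ?ij //; first by ring.
    by move=> P; case: (i \in P); case: (j \in P).
  rewrite (all_sum [:: i; j; l]) /= ?inE ?negb_or ?ij ?kl ?jl //; first by ring.
  by move=> P; case: (i \in P); case: (j \in P); case: (l \in P).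
have [eil|il] := eqVneq i l.
  subst l; rewrite [j == i]eq_sym (negPf ij).
  have [ejk|jk] := eqVneq j k.
    subst k; rewrite (all_sum [:: i; j]) /= ?inE ?ij //; first by ring.
    by move=> P; case: (i \in P); case: (j \in P).
  rewrite (all_sum [:: i; j; k]) /= ?inE ?negb_or ?ij ?ik ?jk //; first by ring.
  by move=> P; case: (i \in P); case: (j \in P); case: (k \in P).
have [ejk|jk] := eqVneq j k.
  subst k; rewrite (negPf kl).
  rewrite (all_sum [:: i; j; l]) /= ?inE ?negb_or ?ij ?il ?kl //; first by ring.
  by move=> P; case: (i \in P); case: (j \in P); case: (l \in P).
have [ejl|jl] := eqVneq j l.
  subst l.
  rewrite (all_sum [:: i; j; k]) /= ?inE ?negb_or ?ij ?ik ?jk //; first by ring.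
  by move=> P; case: (i \in P); case: (j \in P); case: (k \in P).
rewrite (all_sum [:: i; j; k; l]) /= ?inE ?negb_or ?ij ?ik ?il ?jk ?jl ?kl //.
  by ring.
by move=> P; rewrite andbT.
Qed.

(** In the expanded square, each of the four single deltas leaves [N * K1 ^+ 2], and each of the two
    products of deltas identifies the pairs and leaves [N * K2]. *)
Lemma sum_arc_energy2 :
  \sum_(P : {set 'I_n.+1} | #|P| == s) arc_energy P ^+ 2 =
  N * K1 * (c 4 * N * K1 + 4 * (c 3 - c 4) * K1)
  + 2 * (c 2 - 2 * c 3 + c 4) * N * K2.
Proof.
transitivity (\sum_i \sum_j \sum_k \sum_l arc (i - j) * arc (k - l) *
    (\sum_(P : {set 'I_n.+1} | #|P| == s)
       (ind P i * ind P j * (ind P k * ind P l)))).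
  under eq_bigr do rewrite arc_energyE expr2 mulr_suml.
  rewrite exchange_big; apply: eq_bigr => i _ /=.
  under eq_bigr do rewrite mulr_suml.
  rewrite exchange_big; apply: eq_bigr => j _ /=.
  under eq_bigr do rewrite mulr_sumr.
  rewrite exchange_big; apply: eq_bigr => k _ /=.
  under eq_bigr do rewrite mulr_sumr.
  rewrite exchange_big; apply: eq_bigr => l _ /=.
  by rewrite mulr_sumr; apply: eq_bigr => P _; ring.
have kl_sum i j : \sum_k \sum_l arc (i - j) * arc (k - l) *
    (\sum_(P : {set 'I_n.+1} | #|P| == s)
       (ind P i * ind P j * (ind P k * ind P l))) =
    arc (i - j) * (c 4 * N * K1 + 4 * (c 3 - c 4) * K1)
    + 2 * (c 2 - 2 * c 3 + c 4) * arc (i - j) ^+ 2.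
  pose a := arc (i - j); pose d := c 2 - 2 * c 3 + c 4.
  transitivity (\sum_k (a * c 4 * K1
     + a * (c 3 - c 4) * ((i == k)%:R * K1 + arc (k - i)
                          + (j == k)%:R * K1 + arc (k - j))
     + a * d * ((i == k)%:R * arc (k - j) + (j == k)%:R * arc (k - i)))).
    apply: eq_bigr => k _.
    transitivity (\sum_l (a * c 4 * arc (k - l)
       + a * (c 3 - c 4) * ((i == k)%:R * arc (k - l) + (i == l)%:R * arc (k - l)
           + (j == k)%:R * arc (k - l) + (j == l)%:R * arc (k - l))
       + a * d * ((i == k)%:R * ((j == l)%:R * arc (k - l))
                  + (j == k)%:R * ((i == l)%:R * arc (k - l))))).
      by apply: eq_bigr => l _; rewrite sum_four_points -/a -/d; ring.
    rewrite !big_split /= -!mulr_sumr !big_split /= -!mulr_sumr.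
    by rewrite !sum_delta sum_arc_sub_r.
  rewrite !big_split /= -!mulr_sumr !big_split /=.
  rewrite !sum_delta !sum_arc_sub_l sum_const_ord.
  by rewrite -(arcN (j - i)) opprB -/a -/d; ring.
under eq_bigr do under eq_bigr do rewrite kl_sum.
under eq_bigr do rewrite big_split /= -mulr_suml -mulr_sumr
  sum_arc_sub_r sum_arc2_sub_r.
by rewrite big_split /= !sum_const_ord; ring.
Qed.

End Moments.

(** * Variance of the arc energy *)

Lemma natr_ffactS (m k : nat) :
  (m ^_ k.+1)%:R = (m ^_ k)%:R * (m%:R - k%:R) :> rat.
Proof.
rewrite ffactnSr natrM; have [km|mk] := leqP k m; first by rewrite natrB.
by rewrite ffact_small // !mul0r.
Qed.

Lemma arc_energy_variance (s n : nat)
    (N := n.+1%:R : rat) (M := 'C(n.+1, s)%:R : rat) :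
  (0 < s <= n)%N ->
  (\sum_(P : {set 'I_n.+1} | #|P| == s) arc_energy P ^+ 2) / M
    - ((\sum_(P : {set 'I_n.+1} | #|P| == s) arc_energy P) / M) ^+ 2 =
  s%:R * (N - s%:R) * (N - s%:R - 1) * (s%:R - 1) * (N + 1) * N / 90.
Proof.
move=> /andP[s0 sn].
have M0 : M != 0 by rewrite pnatr_eq0 -lt0n bin_gt0 leqW.
rewrite sum_arc_energy2 sum_arc_energy sum_arc sum_arc2 -/N.
have [n3|n3] := leqP 3 n; last first.
  (* Here [n.+1 ^_ 4 = 0] and dividing by it is not possible. *)
  rewrite /supersets_nb card_ord /N /M.
  have : (n == 1) && (s == 1) || (n == 2) && (s == 1) || (n == 2) && (s == 2)%N.
    by lia.
  by move=> /orP[/orP[]|] /andP[/eqP-> /eqP->]; vm_compute.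
have ffE (m : nat) : (m <= 4)%N ->
    (supersets_nb 'I_n.+1 s m)%:R * (n.+1 ^_ m)%:R = M * (s ^_ m)%:R.
  move=> m4; rewrite -!natrM; congr (_%:R).
  by have := @supersets_nb_ffact 'I_n.+1 s m; rewrite card_ord => -> //; lia.
have nz (k : nat) : (k <= 3)%N -> N - k%:R != 0.
  by move=> k3; rewrite subr_eq0 eqr_nat; lia.
have cE (m : nat) : (m <= 4)%N ->
    (supersets_nb 'I_n.+1 s m)%:R = M * (s ^_ m)%:R / (n.+1 ^_ m)%:R.
  by move=> m4; rewrite -ffE // mulfK // pnatr_eq0 -lt0n ffact_gt0; lia.
rewrite !cE // !natr_ffactS !ffactn0 -/N.
have := nz 1%N isT; have := nz 2%N isT; have := nz 3%N isT; have := nz 0%N isT.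
clear ffE cE nz; move: N M M0 => {}N {}M M0; rewrite mulr0n !subr0 => N0 N3 N2 N1.
by field; rewrite N0 N1 N2 N3 M0.
Qed.

(** * Transfer to the uniform distribution on cores *)

Lemma big_fset_seq (T : choiceType) (r : seq T) (F : T -> rat) : uniq r ->
  \sum_(x <- [fset x in r]%fset) F x = \sum_(x <- r) F x.
Proof.
move=> ur; apply: perm_big; apply: uniq_perm => // x.
by rewrite inE.
Qed.

Lemma card_fset_seq (T : choiceType) (r : seq T) : uniq r ->
  #|` [fset x in r]%fset| = size r.
Proof.
move=> ur; apply: perm_size; apply: uniq_perm => // x.
by rewrite inE.
Qed.

Lemma unif_variance_affine (T : choiceType) (C : {fset T})
    (X Y : T -> rat) (a b : rat) :
  C != fset0%fset -> {in C, forall x, X x = a + b * Y x} ->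
  unif_variance C X =
  b ^+ 2 * (unif_expectation C (fun x => Y x ^+ 2) - unif_expectation C Y ^+ 2).
Proof.
move=> C0 XE; rewrite /unif_variance /unif_expectation.
have m0 : #|` C|%:R != 0 :> rat by rewrite pnatr_eq0 cardfs_eq0.
have sE (c : rat) : \sum_(x <- C) c = #|` C|%:R * c.
  by rewrite big_const_seq count_predT iter_addr_0 mulr_natl.
have -> : \sum_(x <- C) X x = #|` C|%:R * a + b * \sum_(x <- C) Y x.
  rewrite -sE mulr_sumr -big_split /=.
  by rewrite big_seq [RHS]big_seq; apply: eq_bigr => x /XE.
set m : rat := #|` C|%:R; set S1 := \sum_(x <- C) Y x.
have -> : \sum_(x <- C) (X x - (m * a + b * S1) / m) ^+ 2 =
    b ^+ 2 * (\sum_(x <- C) Y x ^+ 2) - 2 * b ^+ 2 * (S1 / m) * (\sum_(x <- C) Y x)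
    + m * (b * (S1 / m)) ^+ 2.
  rewrite -[m * _ ^+ 2]sE !mulr_sumr -sumrB -big_split /= big_seq [RHS]big_seq.
  by apply: eq_bigr => x /XE ->; rewrite -mulr_sumr -/S1; field.
by rewrite -/S1; field.
Qed.

Local Open Scope fset_scope.

Theorem theorem2 (s t : nat) (hs : (0 < s)%N) (ht : (0 < t)%N)
    (hst : coprime s t) :
  exists C : {fset seq nat},
    [/\ forall l : seq nat, l \in C <-> st_core_partition s t l,
        C != fset0
      & unif_variance C (fun l => (partition_size l)%:R) =
        1 / 1440%:R * s%:R * t%:R * (t%:R - 1) * (s%:R - 1)
          * (s%:R + t%:R + 1) * (s%:R + t%:R)].
Proof.
pose n := (s + t).-1.
have stE : (s + t = n.+1)%N by rewrite /n; lia.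
have co : coprime s n.+1 by rewrite -stE /coprime gcdnDl.
pose D := [set P : {set 'I_n.+1} | (#|P| == s) && dyck s P].
have DP P : P \in D -> #|P| = s /\ dyck s P by rewrite inE => /andP[/eqP].
pose r := [seq core_of s P | P <- enum D].
have ur : uniq r.
  rewrite map_inj_in_uniq ?enum_uniq // => P Q; rewrite !mem_enum.
  by move=> /DP[cP dP] /DP[cQ dQ]; apply: (core_of_inj co).
pose C := [fset x in r].
have CP (l : seq nat) : l \in C <-> st_core_partition s t l.
  rewrite inE; split=> [/mapP[P]|].
    by rewrite mem_enum => /DP[cP dP] ->; apply: (core_of_st_core co hs stE).
  move=> /(st_core_exists_dyck co hs stE ht)[P [cP dP <-]].
  by apply: map_f; rewrite mem_enum inE cP eqxx.
have sumD (F : rat -> rat) : n.+1%:R * \sum_(P in D) F (arc_energy P) =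
    \sum_(P : {set 'I_n.+1} | #|P| == s) F (arc_energy P).
  by rewrite sum_dyck //; congr (_ * _); apply: eq_bigl => P; rewrite inE.
have cardD : n.+1%:R * #|D|%:R = 'C(n.+1, s)%:R :> rat.
  rewrite -sum1_card natr_sum (sumD (fun=> 1)).
  have := card_draws 'I_n.+1 s; rewrite card_ord => <-.
  by rewrite -sum1_card natr_sum; apply: eq_big => P; rewrite ?inE.
have M0 : 'C(n.+1, s)%:R != 0 :> rat.
  by rewrite pnatr_eq0 -lt0n bin_gt0 -stE leq_addr.
have D0 : #|D|%:R != 0 :> rat.
  by apply: contraNneq M0 => D0; rewrite -cardD D0 mulr0.
have N0 : n.+1%:R != 0 :> rat by rewrite pnatr_eq0.
have cardC : #|` C| = #|D| by rewrite card_fset_seq // size_map -cardE.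
have C0 : C != fset0 by rewrite -cardfs_eq0 cardC; move: D0; rewrite pnatr_eq0.
exists C; split; [exact: CP | exact: C0 | ].
pose a : rat := (s%:R ^+ 2 - 1) * (n.+1%:R ^+ 2 - 1) / 24.
(* [size_core_of] solved for the arc energy, as a function of the core alone. *)
pose Y (l : seq nat) : rat := 4 * (a - (partition_size l)%:R).
have YE P : P \in D -> Y (core_of s P) = arc_energy P.
  by move=> /DP[cP dP]; rewrite /Y size_core_of // -/a; field.
have XE : {in C, forall l, (partition_size l)%:R = (a + - 4^-1 * Y l)%R}.
  by move=> l _; rewrite /Y; field.
rewrite (unif_variance_affine C0 XE).
(* The factor [n.+1] of the cycle lemma cancels, so averages over cores are averages over all
   [s]-subsets. *)
have expC (F : rat -> rat) : unif_expectation C (fun l => F (Y l)) =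
    (\sum_(P : {set 'I_n.+1} | #|P| == s) F (arc_energy P)) / 'C(n.+1, s)%:R.
  rewrite /unif_expectation cardC big_fset_seq // big_map big_enum /=.
  under eq_bigr => P PD do rewrite YE //.
  by rewrite -cardD -sumD -mulf_div divff // mul1r.
rewrite (expC (fun y => y ^+ 2)) (expC id).
rewrite arc_energy_variance; last by rewrite hs -ltnS -stE; lia.
(* Here [N - s] is [t], and the squared slope [1/16] times [1/90] is [1/1440]. *)
by rewrite -stE natrD; field.
Qed.
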